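(* Let $R$ be a commutative Noetherian ring, $M$ a finitely generated $R$-module, $N$ a submodule of $M$ and $\mathrm{Ass}_R(M/N) = \{\mathfrak p_1,\dots,\mathfrak p_n\}$. Let $N = Q_1 \cap \cdots \cap Q_n$ be an irredundant primary decomposition of $N$, where $Q_i$ is $\mathfrak p_i$-primary for all $i=1,\dots,n$. Then $$\mathrm{ir}_M(N) = \mathrm{ir}_M(Q_1) + \cdots + \mathrm{ir}_M(Q_n)$$ if and only if $Q_i$ is a $\mathfrak p_i$-maximal embedded component of $N$ for all embedded associated prime ideals $\mathfrak p_i$ of $N$.
   Context: A submodule $N$ of $M$ is irreducible if it cannot be written as an intersection of two properly larger submodules of $M$. The index of reducibility $\mathrm{ir}_M(N)$ is the number of components of an irredundant decomposition of $N$ as a finite intersection of irreducible submodules of $M$ (no component can be omitted; the empty intersection is $M$); by Noether this number is independent of the decomposition. A submodule $Q$ of $M$ is $\mathfrak p$-primary if $\mathrm{Ass}_R(M/Q)=\{\mathfrak p\}$. An irredundant primary decomposition is a finite intersection of primary submodules with pairwise distinct associated primes in which no component can be omitted. The associated primes of $N$ are the elements of $\mathrm{Ass}_R(M/N)$; such a prime is embedded if it is not minimal in $\mathrm{Ass}_R(M/N)$. For $\mathfrak p\in\mathrm{Ass}_R(M/N)$, $\bigwedge_{\mathfrak p}(N)$ denotes the set of all $\mathfrak p$-primary submodules of $M$ which appear in some irredundant primary decomposition of $N$. A $\mathfrak p$-primary submodule $Q$ is a $\mathfrak p$-maximal embedded component of $N$ if $Q$ is a maximal element (with respect to inclusion)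 of $\bigwedge_{\mathfrak p}(N)$. *)

(* Defs.v *)
From mathcomp Require Import all_boot all_algebra.
From mathcomp Require Import boolp classical_sets.

Set Implicit Arguments.
Unset Strict Implicit.
Unset Printing Implicit Defensive.

Import GRing.Theory.
Local Open Scope ring_scope.
Local Open Scope classical_set_scope.

Section Submodules.
Variables (R : comPzRingType) (M : lmodType R).
Implicit Types (N Q A B : set M).

Definition submodule N : Prop := submod_closed [in N].

Definition finitely_generated N : Prop :=
  exists k (g : 'I_k -> M),
    N = range (fun c : 'I_k -> R => \sum_(i < k) c i *: g i).

(* For k = 0 the intersection is the whole of M. *)
Definition irredundant_inter k (F : 'I_k -> set M) N : Prop :=
  N = \bigcap_i F i /\ forall i, \bigcap_(j in [set~ i]) F j <> N.

Definition irreducible N : Prop :=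
  submodule N /\
  forall A B, submodule A -> submodule B -> N `<` A -> N `<` B ->
    N <> A `&` B.

(* By Noether's theorems, when M is a Noetherian module and N a submodule,
   exactly one k is eligible, so the choice made by xget and its default
   value 0 are then immaterial. *)
Definition index_of_reducibility N : nat :=
  xget 0%N [set k : nat | exists F : 'I_k -> set M,
    (forall i, irreducible (F i)) /\ irredundant_inter F N].

End Submodules.

(* R^o is R seen as a module over itself; its submodules are the ideals. *)
Definition ideal (R : comPzRingType) (I : set R) : Prop :=
  submodule (I : set R^o).

Definition noetherian (R : comPzRingType) : Prop :=
  forall I : set R, ideal I -> finitely_generated (I : set R^o).

Definition prime_ideal (R : comPzRingType) (p : set R) : Prop :=
  [/\ ideal p, ~ p 1 & forall a b, p (a * b) -> p a \/ p b].

Section PrimaryDecomposition.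
Variables (R : comPzRingType) (M : lmodType R).
Implicit Types (N Q : set M) (p q : set R).

(* Ass N is Ass_R(M/N): the set [set a | N (a *: x)] is the annihilator of the
   class of x in M/N. *)
Definition Ass N : set (set R) :=
  [set p | prime_ideal p /\ exists x : M, p = [set a | N (a *: x)]].

Definition embedded N p : Prop :=
  Ass N p /\ ~ (forall q, Ass N q -> q `<=` p -> q = p).

Definition primary p Q : Prop := submodule Q /\ Ass Q = [set p].

Definition irredundant_primary_decomposition n (p : 'I_n -> set R)
    (Q : 'I_n -> set M) N : Prop :=
  [/\ forall i, primary (p i) (Q i), injective p & irredundant_inter Q N].

Definition primary_components N p : set (set M) :=
  [set Q | exists n (p' : 'I_n -> set R) (Q' : 'I_n -> set M),
     irredundant_primary_decomposition p' Q' N /\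
     exists i, p' i = p /\ Q' i = Q].

Definition maximal_embedded_component N p Q : Prop :=
  primary_components N p Q /\
  forall Q', primary_components N p Q' -> Q `<=` Q' -> Q' = Q.

End PrimaryDecomposition.

(* Main.v *)
Require Import Defs.
From mathcomp Require Import all_boot all_algebra.
From mathcomp Require Import boolp classical_sets.

(** Write each Q_i as an irredundant intersection of irreducible submodules
    U_ij, with j ranging over ir(Q_i) indices.  All the U_ij together intersect
    in N, so everything turns on whether this joint family is irredundant.  By
    Noether's exchange argument any irreducible decomposition of N has at least
    ir(N) members, with equality exactly when it is irredundant
    (index_eq_card_irredundant).  Hence the formula ir(N) = sum_i ir(Q_i) says
    that the family (U_ij) is irredundant for N.

    Suppose that it is, let B be the intersection of the Q_l with l <> i, and
    let L be a p_i-primary component of N containing Q_i.  Irredundancy gives,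
    for each j, an element of B outside U_ij and inside all the other U_ik.
    Since each M/U_ij is uniform, these elements make B essential modulo Q_i:
    a submodule containing Q_i and meeting B inside Q_i equals Q_i
    (irreducible_essential).  The submodule L is of this kind, because
    an associated prime of (L inter B)/N is p_i, as this module embeds in M/Q_i,
    and is one of the other primes, as it embeds in the quotient of M by the
    components accompanying L (component_swap).  So
    Q_i is maximal.

    Conversely, if some U_ij can be omitted, let L be the intersection of the
    other U_ik.  Then L is strictly larger than Q_i and can stand in for Q_i
    in the decomposition.  If p_i is embedded, L is a larger p_i-primary
    component (primary_others, replace_component), so Q_i is not maximal.  If
    p_i is minimal, this contradicts the uniqueness of isolated components
    (isolated_component).

    No localization is involved: associated primes are handled through
    colon ideals of elements, and uniformity of M/X for an irreducible X through
    nonzero common multiples of two elements (irreducible_common). *)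

Local Open Scope classical_set_scope.

Section IndexOfReducibility.
Import GRing.Theory.
Local Open Scope ring_scope.
Local Open Scope classical_set_scope.
Set Implicit Arguments.
Unset Strict Implicit.
Unset Printing Implicit Defensive.

(** * Submodules *)

Lemma submoduleP (R : comPzRingType) (M : lmodType R) (N : set M) :
  submodule N <-> N 0 /\ forall a x y, N x -> N y -> N (a *: x + y).
Proof.
split=> [[N0 Nlin]|[N0 Nlin]]; split.
- by rewrite inE in N0.
- by move=> a x y Nx Ny; have := Nlin a x y; rewrite !inE; apply.
- by rewrite inE.
- by move=> a x y; rewrite !inE; apply: Nlin.
Qed.

Lemma idealP (R : comPzRingType) (I : set R) :
  ideal I <-> I 0 /\ forall a b c, I b -> I c -> I (a * b + c).
Proof. exact: (@submoduleP _ R^o). Qed.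

Section SubmoduleCalculus.
Variables (R : comPzRingType) (M : lmodType R).
Implicit Types (N A B X : set M) (a : R) (x y : M).

Lemma submodule0 N : submodule N -> N 0.
Proof. by case/submoduleP. Qed.

Lemma submoduleZ N a x : submodule N -> N x -> N (a *: x).
Proof. by case/submoduleP=> N0 Nlin Nx; rewrite -[_ *: _]addr0; apply: Nlin. Qed.

Lemma submoduleD N x y : submodule N -> N x -> N y -> N (x + y).
Proof. by case/submoduleP=> N0 Nlin Nx Ny; rewrite -[x]scale1r; apply: Nlin. Qed.

Lemma submoduleB N x y : submodule N -> N x -> N y -> N (x - y).
Proof.
move=> sN Nx Ny; apply: submoduleD => //.
by rewrite -scaleN1r; apply: submoduleZ.
Qed.

Lemma submoduleBr N x y : submodule N -> N (x - y) -> N y -> N x.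
Proof. by move=> sN Nxy Ny; rewrite -(subrK y x); apply: submoduleD. Qed.

Lemma submoduleBl N x y : submodule N -> N (x - y) -> N x -> N y.
Proof.
by move=> sN Nxy Nx; rewrite -(subKr x y); apply: submoduleB.
Qed.

Lemma submodule_sum N (I : Type) (r : seq I) (F : I -> M) :
  submodule N -> (forall i, N (F i)) -> N (\sum_(i <- r) F i).
Proof.
move=> sN NF; elim/big_rec: _ => [|i x _ Nx]; first exact: submodule0.
exact: submoduleD.
Qed.

Lemma submoduleT : submodule [set: M].
Proof. exact/submoduleP. Qed.

Lemma submoduleI A B : submodule A -> submodule B -> submodule (A `&` B).
Proof.
move=> /submoduleP[A0 Al] /submoduleP[B0 Bl]; apply/submoduleP; split=> // a x y [? ?] [? ?].
by split; [apply: Al | apply: Bl].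
Qed.

Lemma submodule_bigcap (I : Type) (P : set I) (F : I -> set M) :
  (forall i, P i -> submodule (F i)) -> submodule (\bigcap_(i in P) F i).
Proof.
move=> sF; apply/submoduleP; split=> [i Pi|a x y Fx Fy i Pi]; first exact: submodule0 (sF i Pi).
by case/submoduleP: (sF i Pi) => _; apply; [apply: Fx | apply: Fy].
Qed.

(** The submodule X + Rx. *)
Definition add_line X x : set M := [set y | exists a, X (y - a *: x)].

Lemma submodule_add_line X x : submodule X -> submodule (add_line X x).
Proof.
move=> sX; apply/submoduleP; split=> [|a y z [b Xb] [c Xc]].
  by exists 0; rewrite scale0r subr0; apply: submodule0.
exists (a * b + c).
have -> : a *: y + z - (a * b + c) *: x = a *: (y - b *: x) + (z - c *: x).
  by rewrite scalerDl -scalerA scalerBr opprD addrACA.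
by apply: submoduleD => //; apply: submoduleZ.
Qed.

Lemma proper_add_line X x : submodule X -> ~ X x -> X `<` add_line X x.
Proof.
move=> sX nXx; split=> [y Xy|XxX].
  by exists 0; rewrite scale0r subr0.
apply: nXx; apply: XxX; exists 1; rewrite scale1r subrr; exact: submodule0.
Qed.

(** The annihilator of the class of x in M/N. *)
Definition colon N x : set R := [set a | N (a *: x)].

Lemma ideal_colon N x : submodule N -> ideal (colon N x).
Proof.
move=> sN; apply/idealP; split=> [|a b c Nb Nc]; rewrite /colon /=.
  by rewrite scale0r; apply: submodule0.
by rewrite scalerDl -scalerA; apply: submoduleD => //; apply: submoduleZ.
Qed.

Lemma ideal_colon_sub N x a : submodule N -> colon N x `<=` colon N (a *: x).
Proof.
by move=> sN b Nb; rewrite /colon /= scalerA mulrC -scalerA; apply: submoduleZ.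
Qed.

(** A prime annihilator is shared by all nonzero multiples: as R/p is a domain,
    each of its nonzero elements has annihilator p. *)
Lemma colon_prime_scale N x a : submodule N ->
  prime_ideal (colon N x) -> ~ N (a *: x) -> colon N (a *: x) = colon N x.
Proof.
move=> sN [_ _ pr] nNax; apply/seteqP; split; last exact: ideal_colon_sub.
by move=> b; rewrite /colon /= scalerA => /pr[].
Qed.

Lemma colon_congr N x y : submodule N -> N (x - y) -> colon N x = colon N y.
Proof.
move=> sN Nxy; apply/seteqP; split=> a Na; rewrite /colon /= in Na *.
  by apply: submoduleBl Na; rewrite -?scalerBr; [| apply: submoduleZ].
by apply: submoduleBr Na; rewrite -?scalerBr; [| apply: submoduleZ].
Qed.

End SubmoduleCalculus.

Lemma idealM (R : comPzRingType) (I : set R) a b : ideal I -> I b -> I (a * b).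
Proof. exact: (@submoduleZ _ R^o). Qed.

(** * Chain conditions *)

(** The order of quantifiers makes P n the largest member of the chain. *)
Definition acc (R : comPzRingType) (M : lmodType R) : Prop :=
  forall P : nat -> set M, (forall n, submodule (P n)) ->
    (forall m n, (m <= n)%N -> P m `<=` P n) ->
  exists n, forall m, P m `<=` P n.

(** If every member had a strictly larger one, iterating a choice of larger
    members would give a chain that never stops. *)
Lemma acc_maximal (R : comPzRingType) (M : lmodType R) (F : set (set M)) A0 :
  acc M -> (forall A, F A -> submodule A) -> F A0 ->
  exists2 A, F A & forall B, F B -> A `<=` B -> B `<=` A.
Proof.
move=> accM sF FA0; apply: contrapT => nomax.
have step (A : {A | F A}) : exists B : {B | F B},
    sval A `<=` sval B /\ ~ sval B `<=` sval A.
  case: A => A FA; apply: contrapT => nB; apply: nomax; exists A => // B FB AB.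
  by apply: contrapT => nBA; apply: nB; exists (exist _ B FB).
have [f fP] := choice step.
pose P n := sval (iter n f (exist _ A0 FA0)).
have Pmono m n : (m <= n)%N -> P m `<=` P n.
  elim: n => [|n IH]; first by rewrite leqn0 => /eqP->.
  rewrite leq_eqVlt => /orP[/eqP->//|/IH mn x /mn].
  by have [+ _] := fP (iter n f (exist _ A0 FA0)); apply.
have [n nP] := accM P (fun n => sF _ (svalP (iter n f _))) Pmono.
by have [_] := fP (iter n f (exist _ A0 FA0)); apply; apply: (nP n.+1).
Qed.

(** Finitely many generators of the union of a chain all occur at some finite
    stage. *)
Lemma noetherian_acc (R : comPzRingType) : noetherian R -> acc (R^o : lmodType R).
Proof.
move=> noeth P sP Pmono.
pose U : set R := [set a | exists n, P n a].
have idU : ideal U.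
  apply/submoduleP; split=> [|a b c [m Pb] [n Pc]]; first by exists 0%N; apply: submodule0.
  exists (maxn m n); apply: submoduleD => //.
    by apply: submoduleZ => //; apply: Pmono Pb; apply: leq_maxl.
  by apply: Pmono Pc; apply: leq_maxr.
have [k [g Ug]] := noeth U idU.
have Pg i : exists n, P n (g i).
  suff : U (g i) by [].
  rewrite Ug; exists (fun j => (j == i)%:R) => //.
  rewrite (bigD1 i) //= eqxx scale1r big1 ?addr0 // => j /negPf->.
  by rewrite scale0r.
have [n nP] := choice Pg.
exists (\max_i n i) => m x Px.
have : U x by exists m.
rewrite Ug => -[c _ <-]; apply: submodule_sum => // i.
by apply: submoduleZ => //; apply: Pmono (nP i); apply: leq_bigmax.
Qed.

Section NoetherianModule.
Variables (R : comPzRingType) (M : lmodType R).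
Implicit Types (s : seq M).

(** Defined by recursion, so that chains can be treated one generator at a
    time. *)
Fixpoint span s : set M :=
  if s is g :: s' then add_line (span s') g else [set 0].

Lemma submodule_span s : submodule (span s).
Proof.
elim: s => [|g s IH] /=; last exact: submodule_add_line.
by apply/submoduleP; split=> //= a x y -> ->; rewrite scaler0 addr0.
Qed.

(** A submodule of span (g :: s) inside another one coincides with it as soon as
    both have the same trace on span s and the same ideal of coefficients of g.
    So the chain stops once these two simpler chains do. *)
Lemma acc_span s (P : nat -> set M) : acc (R^o : lmodType R) ->
  (forall n, submodule (P n)) -> (forall m n, (m <= n)%N -> P m `<=` P n) ->
  (forall n, P n `<=` span s) -> exists n, forall m, P m `<=` P n.
Proof.
move=> accR; elim: s P => [|g s IH] P sP Pmono Ps /=.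
  by exists 0%N => m x /Ps ->; apply: submodule0.
pose I n : set R^o := [set a | exists2 x, P n x & span s (x - a *: g)].
have sI n : submodule (I n).
  apply/submoduleP; split=> [|a b c [x Px sx] [y Py sy]].
    exists 0; first exact: submodule0 (sP n).
    by rewrite scale0r subr0; exact: submodule0 (submodule_span s).
  exists (a *: x + y); first by apply: submoduleD => //; apply: submoduleZ.
  have -> : a *: x + y - (a *: b + c) *: g = a *: (x - b *: g) + (y - c *: g).
    by rewrite scalerDl -scalerA scalerBr opprD addrACA.
  have ss := submodule_span s.
  by apply: submoduleD => //; apply: submoduleZ.
have Imono m n : (m <= n)%N -> I m `<=` I n.
  by move=> mn a [x Px sx]; exists x => //; apply: Pmono Px.
have [n1 In1] := accR I sI Imono.
have [|||n2 Pn2] := IH (fun n => P n `&` span s).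
- by move=> n; apply: submoduleI => //; apply: submodule_span.
- by move=> m n mn x [/(Pmono _ _ mn)].
- by move=> n x [].
exists (maxn n1 n2) => m x Px; set n := maxn n1 n2.
have [a xa] := Ps _ _ Px.
have [|y Py ya] := In1 m a; first by exists x.
have [|Pxy _] := Pn2 (maxn m n) (x - y).
  split.
    apply: submoduleB => //; first by apply: Pmono Px; apply: leq_maxl.
    apply: Pmono Py; apply: leq_trans (leq_maxr _ _); exact: leq_maxl.
  have -> : x - y = (x - a *: g) - (y - a *: g) by rewrite opprB addrA subrK.
  exact: submoduleB (submodule_span s) xa ya.
apply: (submoduleBr (y := y)) => //.
  by apply: Pmono Pxy; apply: leq_maxr.
by apply: Pmono Py; apply: leq_maxl.
Qed.

Lemma acc_module : noetherian R -> finitely_generated [set: M] -> acc M.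
Proof.
move=> /noetherian_acc accR [k [g Mg]] P sP Pmono.
apply: (@acc_span [seq g i | i <- enum 'I_k]) => // n x _.
have : [set: M] x by [].
rewrite Mg => -[c _ <-]; rewrite -big_enum /=.
elim: (enum _) => [|i r IH] /=; first by rewrite big_nil.
by exists (c i); rewrite big_cons addrAC subrr add0r.
Qed.

End NoetherianModule.

(** * Irreducible decompositions *)

Section Decompositions.
Variables (R : comPzRingType) (M : lmodType R).
Implicit Types (N A X : set M) (I J : finType).

(** Families are indexed by arbitrary finite types, so that a family of families
    or a family with one member removed is again such a family. *)
Definition decomposes I (F : I -> set M) N : Prop :=
  forall x, N x <-> forall i, F i x.

Definition irredundant I (F : I -> set M) N : Prop :=
  decomposes F N /\ forall i, exists2 x, ~ N x & forall j, j != i -> F j x.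

Lemma irredundant_interP k (F : 'I_k -> set M) N :
  irredundant_inter F N <-> irredundant F N.
Proof.
split=> [[NF irr]|[NF irr]]; split.
- by move=> x; rewrite NF; split=> Fx i; [apply: Fx | move=> _; apply: Fx].
- move=> i; apply: contrapT => noi; apply: (irr i).
  apply/seteqP; split=> x; last by rewrite NF => Fx j _; apply: Fx.
  move=> Fx; apply: contrapT => nNx; apply: noi; exists x => // j ji.
  by apply: Fx => /eqP; rewrite (negPf ji).
- apply/seteqP; split=> x; first by move=> /NF Fx i _.
  by move=> Fx; apply/NF => i; apply: Fx.
- move=> i Ni; have [x nNx Fx] := irr i; apply: nNx; rewrite -Ni => j /= /eqP.
  exact: Fx.
Qed.

Lemma irredundant_enum I (F : I -> set M) N :
  irredundant F N -> irredundant (fun k : 'I_#|I| => F (enum_val k)) N.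
Proof.
move=> [NF irr]; split=> [x|k].
  rewrite NF; split=> Fx i; first exact: Fx.
  by rewrite -(enum_rankK i); apply: Fx.
have [x nNx Fx] := irr (enum_val k); exists x => // j jk; apply: Fx.
by apply: contraNneq jk => /enum_val_inj->.
Qed.

Definition others I (i : I) (F : I -> set M) (j : {j : I | j != i}) : set M :=
  F (val j).

Lemma decomposes_others I (F : I -> set M) N :
  decomposes F N -> ~ irredundant F N -> exists i, decomposes (others (i := i) F) N.
Proof.
move=> NF nirr; apply: contrapT => noi; apply: nirr; split=> // i.
apply: contrapT => nx; apply: noi; exists i => x; split=> [/NF Fx j|Fx]; first exact: Fx.
apply: contrapT => nNx; apply: nx; exists x => // j ji.
exact: (Fx (exist _ j ji)).
Qed.

Lemma card_others I (i : I) : (#|{: {j : I | j != i}}| < #|I|)%N.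
Proof.
rewrite card_sig (eq_card (B := predC1 i)) // cardC1 prednK //.
by apply/card_gt0P; exists i.
Qed.

Lemma decomposes_submodule I (F : I -> set M) N :
  (forall i, submodule (F i)) -> decomposes F N -> submodule N.
Proof.
move=> sF NF; apply/submoduleP; split=> [|a x y /NF Fx /NF Fy].
  by apply/NF => i; apply: submodule0.
by apply/NF => i; apply: submoduleD => //; apply: submoduleZ.
Qed.

(** The quotient by an irreducible X is uniform: the nonzero submodules spanned
    by z and w intersect, because X + Rz and X + Rw intersect in more than X. *)
Lemma irreducible_common X z w : irreducible X -> ~ X z -> ~ X w ->
  exists a b, ~ X (a *: z) /\ X (a *: z - b *: w).
Proof.
move=> [sX irrX] nXz nXw.
have [y [[a ya] [b yb]] nXy] :
    exists2 y, (add_line X z `&` add_line X w) y & ~ X y.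
  apply: contrapT => noy; apply: (irrX (add_line X z) (add_line X w)).
  - exact: submodule_add_line.
  - exact: submodule_add_line.
  - exact: proper_add_line.
  - exact: proper_add_line.
  apply/seteqP; split=> y Xy.
    by split; exists 0; rewrite scale0r subr0.
  by apply: contrapT => nXy; apply: noy; exists y.
exists a, b; split; first by move=> Xaz; apply/nXy/(submoduleBr sX ya).
have -> : a *: z - b *: w = (y - b *: w) - (y - a *: z).
  by rewrite opprB [RHS]addrC addrA subrK.
exact: submoduleB.
Qed.

(** Treating the indices one after the other, z is multiplied each time by a
    scalar that makes it congruent to a multiple of w j modulo X j but keeps it
    outside some X k; the congruences already obtained persist under scaling. *)
Lemma simultaneous_multiple J (X : J -> set M) (w : J -> M) z :
  (forall j, irreducible (X j)) -> (forall j, ~ X j (w j)) ->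
  ~ (forall j, X j z) ->
  exists a, ~ (forall j, X j (a *: z)) /\
            forall j, exists b, X j (a *: z - b *: w j).
Proof.
move=> irrX nXw nXz.
have sX j : submodule (X j) by case: (irrX j).
suff [a nXa aP] : exists2 a, ~ (forall j, X j (a *: z)) &
    forall j, j \in enum J -> exists b, X j (a *: z - b *: w j).
  by exists a; split=> // j; apply: aP; rewrite mem_enum.
elim: (enum J) => [|j s [a nXa aP]].
  by exists 1; rewrite ?scale1r.
(* When a *: z is already zero modulo X j, the multiple 0 of w j will do. *)
have [Xja|nXja] := pselect (X j (a *: z)).
  exists a => // i; rewrite inE => /orP[/eqP->|/aP//].
  by exists 0; rewrite scale0r subr0.
have [c [b [nXc Xcb]]] := irreducible_common (irrX j) nXja (nXw j).
exists (c * a); first by move=> /(_ j); rewrite -scalerA.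
move=> i; rewrite inE -scalerA => /orP[/eqP->|/aP[d Xd]]; first by exists b.
by exists (c * d); rewrite -scalerA -scalerBr; apply: submoduleZ.
Qed.

(** Noether's exchange: X may be replaced by some member of any other
    decomposition.  Otherwise each (A inter Y j) has an element w j outside X;
    nonzero multiples of the w j that agree modulo X also agree modulo N, since
    they lie in A, and so lie in every Y j, hence in N. *)
Lemma exchange J (Y : J -> set M) A X N (j0 : J) :
  irreducible X -> submodule A -> (forall j, submodule (Y j)) ->
  (forall x, N x <-> X x /\ A x) -> decomposes Y N ->
  exists j, forall x, A x -> Y j x -> X x.
Proof.
move=> irrX sA sY NXA NY; have sX : submodule X by case: irrX.
apply: contrapT => noj.
have /choice[w wP] j : exists x, [/\ A x, Y j x & ~ X x].
  apply: contrapT => nox; apply: noj; exists j => x Ax Yx.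
  by apply: contrapT => nXx; apply: nox; exists x.
have [||a [nXa aP]] := @simultaneous_multiple J (fun=> X) w (w j0) (fun=> irrX).
- by move=> j; case: (wP j).
- by move=> /(_ j0); case: (wP j0).
have {aP}[b bP] := choice aP.
apply: nXa => _; apply: (submoduleBr sX (bP j0)).
suff /NXA[//] : N (b j0 *: w j0).
apply/NY => j; apply: (submoduleBr (y := b j *: w j)) => //; last first.
  by apply: submoduleZ => //; case: (wP j).
apply: (NY _).1; apply/NXA; split.
  have -> : b j0 *: w j0 - b j *: w j =
      (a *: w j0 - b j *: w j) - (a *: w j0 - b j0 *: w j0).
    by rewrite opprB [RHS]addrC addrA subrK.
  exact: submoduleB.
by apply: submoduleB => //; apply: submoduleZ => //; [case: (wP j0) | case: (wP j)].
Qed.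

(** The submodule A accumulates the members already exchanged. *)
Lemma exchange_all J (Y : J -> set M) I (X : I -> set M) (s : seq I) A N (j0 : J) :
  (forall i, irreducible (X i)) -> submodule A -> (forall j, submodule (Y j)) ->
  decomposes Y N ->
  (forall x, N x <-> A x /\ forall i, i \in s -> X i x) ->
  exists2 t : seq J, size t = size s &
    forall x, A x -> (forall j, j \in t -> Y j x) -> N x.
Proof.
move=> irrX; elim: s A => [|i s IH] A sA sY NY NA.
  by exists [::] => // x Ax _; apply/NA.
pose A' := A `&` \bigcap_(k in [set k | k \in s]) X k.
have sA' : submodule A'.
  by apply: submoduleI => //; apply: submodule_bigcap => k _; case: (irrX k).
have [x|j jP] := exchange j0 (irrX i) sA' sY _ NY.
  rewrite NA; split=> [[Ax Xx]|[Xx [Ax Xsx]]].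
    split; first by apply: Xx; rewrite mem_head.
    by split=> // k ks; apply: Xx; rewrite inE [k \in s]ks orbT.
  by split=> // k; rewrite inE => /orP[/eqP->|/Xsx].
have [||t st tP] := IH (A `&` Y j) _ sY NY.
- exact: submoduleI.
- move=> x; split=> [Nx|[[Ax Yx] Xx]].
    have /NA[Ax Xx] := Nx; split; first by split=> //; exact: (NY _).1.
    by move=> k ks; apply: Xx; rewrite inE ks orbT.
  apply/NA; split=> // k; rewrite inE => /orP[/eqP->|/Xx//].
  exact: jP.
exists (j :: t); first by rewrite /= st.
move=> x Ax Yx; apply: tP; last by move=> k kt; apply: Yx; rewrite inE kt orbT.
by split=> //; apply: Yx; rewrite mem_head.
Qed.

(** After all of X has been exchanged, at most #|I| members of Y intersect in N;
    since Y is irredundant, they are all its members. *)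
Lemma irredundant_leq I J (X : I -> set M) (Y : J -> set M) N :
  (forall i, irreducible (X i)) -> decomposes X N ->
  (forall j, submodule (Y j)) -> irredundant Y N -> (#|J| <= #|I|)%N.
Proof.
move=> irrX NX sY [NY irr].
have [->//|/card_gt0P[j0 _]] := posnP #|J|.
have [x|t st tP] := exchange_all (s := enum I) (N := N) j0 irrX (submoduleT M) sY NY.
  by rewrite NX; split=> [Xx|[_ Xx] i]; [split | apply: Xx; rewrite mem_enum].
rewrite [#|I|]cardE -st [#|J|]cardE; apply: uniq_leq_size (enum_uniq _) _ => j _.
apply: contrapT => /negP jt; have [x nNx Yx] := irr j; apply/nNx/tP => // k kt.
by apply: Yx; apply: contraNneq jt => <-.
Qed.

Lemma index_irredundant I (X : I -> set M) N :
  (forall i, irreducible (X i)) -> irredundant X N ->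
  index_of_reducibility N = #|I|.
Proof.
move=> irrX NX; apply: xget_unique => [|k [F [irrF /irredundant_interP NF]]].
  exists (fun k => X (enum_val k)); split=> [k|]; first exact: irrX.
  exact/irredundant_interP/irredundant_enum.
rewrite -[k]card_ord; apply/eqP; rewrite eqn_leq.
have sX i : submodule (X i) by case: (irrX i).
have sF i : submodule (F i) by case: (irrF i).
rewrite (irredundant_leq irrX NX.1 sF NF).
exact: irredundant_leq irrF NF.1 sX NX.
Qed.

(** A maximal counterexample is not irreducible, so it is the intersection of
    two larger submodules, both of which have decompositions. *)
Lemma exists_irreducible_decomposition N : acc M -> submodule N ->
  exists (I : finType) (X : I -> set M),
    (forall i, irreducible (X i)) /\ decomposes X N.
Proof.
move=> accM sN; apply: contrapT => noN.
pose bad := [set A : set M | submodule A /\ ~ exists (I : finType) (X : I -> set M),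
    (forall i, irreducible (X i)) /\ decomposes X A].
have sbad A : bad A -> submodule A by case.
have [A [sA noA] maxA] := acc_maximal accM sbad (conj sN noN).
have good B : submodule B -> A `<` B -> exists (I : finType) (X : I -> set M),
    (forall i, irreducible (X i)) /\ decomposes X B.
  by move=> sB [AB nBA]; apply: contrapT => noB; apply: nBA; exact: maxA.
apply: (noA); exists unit, (fun=> A); split=> [_|x]; last by split=> [//|/(_ tt)].
split=> // B C sB sC AB AC ABC.
have [I [X [irrX BX]]] := good B sB AB.
have [J [Y [irrY CY]]] := good C sC AC.
apply: noA; exists (I + J)%type, (fun u => match u with inl i => X i | inr j => Y j end).
split=> [[]//|x]; rewrite ABC; split=> [[/BX Xx /CY Yx] []//|XYx].
by split; [apply/BX => i; apply: (XYx (inl i)) | apply/CY => j; apply: (XYx (inr j))].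
Qed.

Lemma exists_irredundant_decomposition I (X : I -> set M) N :
  (forall i, irreducible (X i)) -> decomposes X N ->
  exists (J : finType) (Y : J -> set M),
    [/\ forall j, irreducible (Y j), irredundant Y N & (#|J| <= #|I|)%N].
Proof.
have [m] := ubnP #|I|; elim: m I X => // m IH I X; rewrite ltnS => Im irrX NX.
have [irr|/(decomposes_others NX)[i NXi]] := pselect (irredundant X N).
  by exists I, X.
have [||J [Y [irrY NY JI]]] := IH _ _ _ _ NXi.
- exact: leq_trans (card_others i) Im.
- by move=> j; apply: irrX.
exists J, Y; split=> //; exact: leq_trans JI (ltnW (card_others i)).
Qed.

Lemma index_decomposition N : acc M -> submodule N ->
  exists X : 'I_(index_of_reducibility N) -> set M,
    (forall i, irreducible (X i)) /\ irredundant X N.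
Proof.
move=> accM sN; have [I [X [irrX NX]]] := exists_irreducible_decomposition accM sN.
have [J [Y [irrY NY _]]] := exists_irredundant_decomposition irrX NX.
rewrite (index_irredundant irrY NY); exists (fun k => Y (enum_val k)).
by split=> [k|]; [exact: irrY | exact: irredundant_enum].
Qed.

(** A redundant family can be thinned to an irredundant one with strictly fewer
    members, and the number of members of the latter is the index. *)
Lemma index_eq_card_irredundant I (X : I -> set M) N :
  (forall i, irreducible (X i)) -> decomposes X N ->
  index_of_reducibility N = #|I| <-> irredundant X N.
Proof.
move=> irrX NX; split=> [indN|]; last exact: index_irredundant.
apply: contrapT => /(decomposes_others NX)[i NXi].
have [|J [Y [irrY NY JI]]] := exists_irredundant_decomposition _ NXi.
  by move=> j; apply: irrX.
have := leq_ltn_trans JI (card_others i).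
by rewrite -indN (index_irredundant irrY NY) ltnn.
Qed.

End Decompositions.
(** * Associated primes and primary submodules *)

Section Primary.
Variables (R : comPzRingType) (M : lmodType R).
Implicit Types (N Q X : set M) (p q : set R) (I : finType).

(** Among the proper annihilators of multiples of x modulo N, one that is maximal
    is prime; this yields an associated prime of every nonzero cyclic submodule. *)
Lemma associated_multiple N x : noetherian R -> submodule N -> ~ N x ->
  exists2 a, ~ N (a *: x) & prime_ideal (colon N (a *: x)).
Proof.
move=> /noetherian_acc accR sN nNx.
pose F : set (set R^o) := [set J | exists2 a, ~ N (a *: x) & J = colon N (a *: x)].
have sF J : F J -> submodule J by case=> a _ ->; apply: ideal_colon.
have F1 : F (colon N (1 *: x)) by exists 1; rewrite ?scale1r.
have [_ [a nNax ->] maxa] := acc_maximal accR sF F1.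
exists a => //; split; first exact: ideal_colon.
  by rewrite /colon /= scale1r.
move=> b c Nbc; have [Nc|nNc] := pselect (N (c *: (a *: x))); [by right | left].
apply: (maxa (colon N (c *: (a *: x)))).
- by exists (c * a); rewrite -scalerA.
- exact: ideal_colon_sub.
- by rewrite /colon /= scalerA.
Qed.

(** Choosing in each J i an element outside p, their product lies in all J i and
    not in p. *)
Lemma prime_inter I (J : I -> set R) p : prime_ideal p ->
  (forall i, ideal (J i)) -> (forall a, (forall i, J i a) -> p a) ->
  exists i, J i `<=` p.
Proof.
move=> [idp p1 pM] idJ Jp; apply: contrapT => noi.
have /choice[c cP] i : exists a, J i a /\ ~ p a.
  apply: contrapT => noa; apply: noi; exists i => a Ja.
  by apply: contrapT => npa; apply: noa; exists a.
suff [a npa aP] : exists2 a, ~ p a & forall i, i \in enum I -> J i a.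
  by apply: npa; apply: Jp => i; apply: aP; rewrite mem_enum.
elim: (enum I) => [|i s [a npa aP]]; first by exists 1.
have [Jc npc] := cP i.
exists (a * c i) => [/pM[]//|j]; rewrite inE => /orP[/eqP->|/aP Ja].
  exact: idealM.
by rewrite mulrC; apply: idealM.
Qed.

(** The prime (N : x) is the intersection of the larger ideals (F i : x), so it
    contains, and then equals, one of them. *)
Lemma colon_decomposes I (F : I -> set M) N x :
  (forall i, submodule (F i)) -> decomposes F N -> prime_ideal (colon N x) ->
  exists i, colon (F i) x = colon N x.
Proof.
move=> sF NF pr; have [||i iP] := @prime_inter _ (fun i => colon (F i) x) _ pr.
- by move=> i; apply: ideal_colon.
- by move=> a Fa; apply/NF.
by exists i; apply/seteqP; split=> // a /NF Fa; apply: Fa.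
Qed.

Lemma colon_primary p Q x : primary p Q -> prime_ideal (colon Q x) -> colon Q x = p.
Proof.
move=> [_ AssQ] pr.
by have : Ass Q (colon Q x); [split=> //; exists x | rewrite AssQ].
Qed.

(** A module with irreducible zero submodule has at most one associated prime:
    two of them would both be the annihilator of a common nonzero multiple. *)
Lemma colon_irreducible X x y : irreducible X ->
  prime_ideal (colon X x) -> prime_ideal (colon X y) -> colon X x = colon X y.
Proof.
move=> irrX px py; have [sX _] := irrX.
have [||a [b [nXa Xab]]] := @irreducible_common _ _ X x y irrX.
- by case: px => _; rewrite /colon /= scale1r.
- by case: py => _; rewrite /colon /= scale1r.
have nXb : ~ X (b *: y) by move=> Xb; apply/nXa/(submoduleBr sX Xab).
by rewrite -(colon_prime_scale sX px nXa) (colon_congr sX Xab) colon_prime_scale.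
Qed.

(** An element outside X i and inside the other components has the same
    annihilator modulo X i as modulo Q, which links the prime of X i to p. *)
Lemma colon_irreducible_component p Q I (X : I -> set M) i x :
  noetherian R -> primary p Q -> (forall i, irreducible (X i)) -> irredundant X Q ->
  prime_ideal (colon (X i) x) -> colon (X i) x = p.
Proof.
move=> noeth prQ irrX [QX irr] px; have [sQ _] := prQ.
have [c nQc Xc] := irr i.
have [a nQac pr] := associated_multiple noeth sQ nQc.
suff eqc : colon (X i) (a *: c) = p.
  rewrite -eqc; apply: colon_irreducible => //.
  by rewrite eqc -(colon_primary prQ pr).
rewrite -(colon_primary prQ pr); apply/seteqP; split=> b; last by move=> /QX Xb; apply: Xb.
move=> Xb; apply/QX => j; have [->//|/Xc Xj] := eqVneq j i.
by have [sX _] := irrX j; apply: submoduleZ => //; apply: submoduleZ.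
Qed.

(** The submodules W k killed by s ^+ k modulo Q become stationary at some W n.
    If W n were proper, an associated prime of M/W n would be one of M/Q, namely
    p; but s is a nonzerodivisor on M/W n. *)
Lemma primary_nilpotent p Q s y : noetherian R -> acc M -> primary p Q -> p s ->
  exists k, Q (s ^+ k *: y).
Proof.
move=> noeth accM prQ ps; have [sQ _] := prQ.
pose W k : set M := [set x | Q (s ^+ k *: x)].
have sW k : submodule (W k).
  apply/submoduleP; split=> [|a u v Qu Qv]; rewrite /W /=.
    by rewrite scaler0; apply: submodule0.
  rewrite scalerDr scalerA mulrC -scalerA.
  by apply: submoduleD => //; apply: submoduleZ.
have Wmono m n : (m <= n)%N -> W m `<=` W n.
  move=> mn u Wu; rewrite /W /= -(subnK mn) exprD -scalerA.
  exact: submoduleZ.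
have [n nP] := accM W sW Wmono.
exists n; apply: contrapT => nWy.
have [a nWay pr] := associated_multiple noeth (sW n) nWy.
have eqc : colon (W n) (a *: y) = colon Q (s ^+ n *: (a *: y)).
  have swap b (z : M) : s ^+ n *: (b *: z) = b *: (s ^+ n *: z) by rewrite scalerA mulrC -scalerA.
  by apply/seteqP; split=> b; rewrite /colon /W /= (swap b).
rewrite eqc in pr; have := ps; rewrite -(colon_primary prQ pr) => Qs.
apply: nWay; apply: (nP n.+1); rewrite /W /= exprS -scalerA; exact: Qs.
Qed.

End Primary.

(** * Components of a primary decomposition *)

Section Components.
Variables (R : comPzRingType) (M : lmodType R).
Implicit Types (N L P : set M).

(** The p i-component Q' l of one decomposition can replace the p i-component of
    another.  If x were in Q' l and in all Q j with j <> i but not in N, some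
    multiple a *: x would have a prime annihilator modulo N; computed through Q
    it is p i, computed through Q' it is one of the other primes. *)
Lemma component_swap N n (p : 'I_n -> set R) Q m (p' : 'I_m -> set R) Q' i l x :
  noetherian R -> submodule N ->
  irredundant_primary_decomposition p Q N ->
  irredundant_primary_decomposition p' Q' N ->
  p' l = p i -> Q' l x -> (forall j, j != i -> Q j x) -> N x.
Proof.
move=> noeth sN [prQ _ /irredundant_interP[NQ _]] [prQ' injp' /irredundant_interP[NQ' _]].
move=> pli Q'x Qx; apply: contrapT => nNx.
have sQ j : submodule (Q j) by case: (prQ j).
have sQ' j : submodule (Q' j) by case: (prQ' j).
have [a nNax pr] := associated_multiple noeth sN nNx.
have eqi : colon N (a *: x) = p i.
  have eqc : colon N (a *: x) = colon (Q i) (a *: x).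
    apply/seteqP; split=> b; first by move=> /NQ Qb; apply: Qb.
    move=> Qb; apply/NQ => j; have [->//|/Qx Qj] := eqVneq j i.
    by apply: submoduleZ => //; apply: submoduleZ.
  by rewrite eqc; apply: colon_primary => //; rewrite -eqc.
pose D := others (i := l) Q'.
have ND b : colon N (a *: x) b <-> forall j, D j (b *: (a *: x)).
  split=> [/NQ' Q'b j|Db]; first exact: Q'b.
  apply/NQ' => j; have [->|jl] := eqVneq j l; last exact: (Db (exist _ j jl)).
  by apply: submoduleZ => //; apply: submoduleZ.
have [||[j jl] /= jP] := @prime_inter _ _ (fun j => colon (D j) (a *: x)) _ pr.
- by move=> j; apply: ideal_colon; apply: sQ'.
- by move=> b Db; apply/ND.
have eqj : colon (Q' j) (a *: x) = colon N (a *: x).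
  by apply/seteqP; split=> // b /NQ' Q'b; apply: Q'b.
have := colon_primary (prQ' j); rewrite -eqj in pr => /(_ _ pr).
rewrite eqj eqi -pli => /esym/injp' e; by move: (jl); rewrite e eqxx.
Qed.

(** Modulo the intersection of the X j, the submodule B is essential, because the
    elements w span in the direct sum of the uniform modules M/X j a submodule
    meeting every factor. *)
Lemma irreducible_essential (J : finType) (X : J -> set M) (B L : set M) :
  (forall j, irreducible (X j)) -> submodule B -> submodule L ->
  (forall j, exists w, [/\ B w, ~ X j w & forall k, k != j -> X k w]) ->
  (forall x, (forall j, X j x) -> L x) ->
  (forall x, L x -> B x -> forall j, X j x) ->
  forall x, L x -> forall j, X j x.
Proof.
move=> irrX sB sL /choice[w wP] XL LBX x Lx; apply: contrapT => nXx.
have sX j : submodule (X j) by case: (irrX j).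
have [|a [nXa /choice[b bP]]] := simultaneous_multiple (w := w) irrX _ nXx.
  by move=> j; case: (wP j).
(* The terms with k <> j vanish modulo X j, so u is congruent to a *: x modulo
   every X j. *)
pose u := \sum_j b j *: w j.
have Xau j : X j (a *: x - u).
  rewrite /u (bigD1 j) //= opprD addrA; apply: submoduleB => //.
  elim/big_ind: _ => [|y z Xy Xz|k kj]; first exact: submodule0.
    exact: submoduleD.
  by apply: submoduleZ => //; have [_ _] := wP k; apply; rewrite eq_sym.
have Lu : L u by apply: (submoduleBl sL (XL _ Xau)); apply: submoduleZ.
have Bu : B u.
  by apply: submodule_sum => // j; apply: submoduleZ => //; case: (wP j).
by apply: nXa => j; apply: (submoduleBr (sX j) (Xau j)); apply: LBX.
Qed.

(** Removing a component keeps an irreducible decomposition p-primary, unless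
    nothing but M is left. *)
Lemma primary_others p P (I : finType) (X : I -> set M) i L :
  noetherian R -> primary p P -> (forall i, irreducible (X i)) -> irredundant X P ->
  decomposes (others (i := i) X) L -> (exists x, ~ L x) -> primary p L.
Proof.
move=> noeth prP irrX PX LX [x nLx].
have sX j : submodule (X j) by case: (irrX j).
have sXo j : submodule (others (i := i) X j) by apply: sX.
have sL : submodule L by apply: decomposes_submodule LX.
have colonL y : prime_ideal (colon L y) -> colon L y = p.
  move=> pr; have [j eqj] := colon_decomposes sXo LX pr.
  rewrite -eqj; apply: (colon_irreducible_component noeth prP irrX PX).
  by rewrite -[X (val j)]/(others (i := i) X j) eqj.
split=> //; apply/seteqP; split=> [q [prq [y qy]]|_ ->].
  by rewrite /set1 /= qy; apply: colonL; rewrite /colon -qy.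
have [a _ pr] := associated_multiple noeth sL nLx.
by rewrite -(colonL _ pr); split=> //; exists (a *: x).
Qed.

(** Uniqueness of isolated components.  Take y in L with annihilator p i modulo
    Q i.  Then p i contains the intersection of the (Q j : y) with j <> i, hence
    one of them, hence p j since Q j is primary; minimality of p i forbids this. *)
Lemma isolated_component N n (p : 'I_n -> set R) (Q : 'I_n -> set M) i L :
  noetherian R -> acc M -> injective p -> Ass N = range p ->
  (forall j, primary (p j) (Q j)) -> ~ embedded N (p i) ->
  submodule L -> (forall x, L x -> (forall j, j != i -> Q j x) -> Q i x) ->
  L `<=` Q i.
Proof.
move=> noeth accM injp AssN prQ nemb sL LQ x Lx; apply: contrapT => nQx.
have sQ j : submodule (Q j) by case: (prQ j).
have [a nQax pr] := associated_multiple noeth (sQ i) nQx.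
have eqp := colon_primary (prQ i) pr.
have [idp p1 pM] : prime_ideal (p i) by rewrite -eqp.
have [||[j ji] /= jP] :=
    @prime_inter _ _ (fun j => colon (others (i := i) Q j) (a *: x)) _ pr.
- by move=> j; apply: ideal_colon; apply: sQ.
- move=> b Qb; apply: LQ => [|j ji]; last exact: (Qb (exist _ j ji)).
  by apply: submoduleZ => //; apply: submoduleZ.
rewrite eqp in jP.
have pji : p j `<=` p i.
  move=> s ps; have [k /jP] := primary_nilpotent (a *: x) noeth accM (prQ j) ps.
  by elim: k => [|k IH]; rewrite ?expr0 // exprS => /pM[].
apply: nemb; split; first by rewrite AssN; exists i.
move=> /(_ (p j)) e; move: (ji); rewrite (injp j i) ?eqxx //.
by apply: e => //; rewrite AssN; exists j.
Qed.

Lemma replace_component N n (p : 'I_n -> set R) (Q : 'I_n -> set M) i L :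
  irredundant_primary_decomposition p Q N -> primary (p i) L -> Q i `<=` L ->
  (forall x, L x -> (forall j, j != i -> Q j x) -> N x) ->
  primary_components N (p i) L.
Proof.
move=> [prQ injp /irredundant_interP[NQ irr]] prL QL LN.
pose Q' j := if j == i then L else Q j.
have QQ' j x : Q j x -> Q' j x by rewrite /Q'; case: eqVneq => [->|//]; apply: QL.
have Q'E j : j != i -> Q' j = Q j by rewrite /Q' => /negPf->.
exists n, p, Q'; split; last by exists i; rewrite /Q' eqxx.
split=> //; first by move=> j; rewrite /Q'; case: eqVneq => [->|].
apply/irredundant_interP; split=> [x|j].
  split=> [/NQ Qx j|Q'x]; first exact/QQ'/Qx.
  apply: LN => [|j ji]; first by have := Q'x i; rewrite /Q' eqxx.
  by rewrite -Q'E.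
have [x nNx Qx] := irr j; exists x => // k kj; exact/QQ'/Qx.
Qed.

End Components.
End IndexOfReducibility.

Theorem theorem3p2 (R : comPzRingType) (M : lmodType R) (N : set M)
    (n : nat) (p : 'I_n -> set R) (Q : 'I_n -> set M) :
  noetherian R ->
  finitely_generated [set: M] ->
  submodule N ->
  Ass N = range p ->
  irredundant_primary_decomposition p Q N ->
  index_of_reducibility N = (\sum_(i < n) index_of_reducibility (Q i))%N
  <->
  (forall i : 'I_n, embedded N (p i) ->
     maximal_embedded_component N (p i) (Q i)).
Proof.
move=> noeth fgM sN AssN decQ.
have accM := acc_module noeth fgM.
have [prQ injp /irredundant_interP[NQ irrQ]] := decQ.
have sQ j : submodule (Q j) by case: (prQ j).
pose U i := sval (cid (index_decomposition accM (sQ i))).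
have UP i : (forall j, irreducible (U i j)) /\ irredundant (U i) (Q i).
  exact: svalP (cid (index_decomposition accM (sQ i))).
have irrU i j : irreducible (U i j) by apply: (UP i).1.
have QU i : irredundant (U i) (Q i) by case: (UP i).
have sU i j : submodule (U i j) by case: (irrU i j).
pose T := {i : 'I_n & 'I_(index_of_reducibility (Q i))}.
pose V (t : T) := U (tag t) (tagged t).
have irrV t : irreducible (V t) by apply: irrU.
have NV : decomposes V N.
  move=> x; split=> [/NQ Qx [i j]|Vx]; first exact: ((QU i).1 x).1.
  by apply/NQ => i; apply/(QU i).1 => j; apply: (Vx (existT _ i j)).
(* The sum of the indices counts the joint family, so the formula is about its
   irredundancy. *)
have -> : (\sum_(i < n) index_of_reducibility (Q i))%N = #|{: T}|.
  rewrite card_tagged sumnE big_map big_enum /=.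
  by apply: eq_bigr => i _; rewrite card_ord.
rewrite (index_eq_card_irredundant irrV NV).
split=> [[_ irr] i _|maxQ].
  split; first by exists n, p, Q; split=> //; exists i.
  move=> L compL QL; apply/seteqP; split=> // x Lx.
  have [m [p' [Q' [decQ' [l [pl Ql]]]]]] := compL.
  rewrite -{}Ql in compL QL Lx *.
  have sL : submodule (Q' l) by case: decQ' => prQ' _ _; case: (prQ' l).
  pose B := \bigcap_(j in [set j | j != i]) Q j.
  apply/(QU i).1; apply: (irreducible_essential (B := B) (L := Q' l)) => //.
  - exact: submodule_bigcap.
  - move=> j; have [w nNw Vw] := irr (existT _ i j); exists w.
    have Bw : B w.
      move=> k /= ki; apply/(QU k).1 => h; apply: (Vw (existT _ k h)).
      by apply: contraNneq ki => /(congr1 tag) /= ->.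
    have Uw k : k != j -> U i k w.
      move=> kj; apply: (Vw (existT _ i k)); apply: contraNneq kj => /eqP.
      by rewrite eq_Tagged.
    split=> // Ujw; apply/nNw/NQ => k; have [->|ki] := eqVneq k i; last exact: Bw.
    by apply/(QU i).1 => h; have [->|/Uw] := eqVneq h j.
  - by move=> y Uy; apply: QL; apply/(QU i).1.
  - move=> y Ly By; apply/(QU i).1; apply: (NQ y).1.
    exact: component_swap noeth sN decQ decQ' pl Ly By.
apply: contrapT => /(decomposes_others NV)[[i j] NVo].
pose L := \bigcap_(k in [set k | k != j]) U i k.
have LU : decomposes (others (i := j) (U i)) L.
  move=> x; split=> [Lx [k kj]|Ux k kj]; first exact: Lx.
  exact: (Ux (exist _ k kj)).
have QL : Q i `<=` L by move=> x /(QU i).1 Ux k _; apply: Ux.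
have sL : submodule L by apply: submodule_bigcap.
have LN x : L x -> (forall k, k != i -> Q k x) -> N x.
  move=> Lx Qx; apply/NVo => -[[k h] /= kh]; rewrite /others /V /=.
  have [e|/Qx/(QU k).1] := eqVneq k i; last exact.
  subst k; apply: Lx; apply: contraNneq kh => ->; exact: eqxx.
have LQ : ~ L `<=` Q i.
  move=> LQ; have [x nQx Ux] := (QU i).2 j; apply: nQx; apply: LQ => k; exact: Ux.
apply: LQ; have [emb|nemb] := pselect (embedded N (p i)).
  have prL : primary (p i) L.
    apply: primary_others noeth (prQ i) (irrU i) (QU i) LU _.
    by have [x nNx Qx] := irrQ i; exists x => Lx; apply/nNx/LN.
  have [_ /(_ L _ QL)->//] := maxQ i emb.
  exact: replace_component decQ prL QL LN.
apply: (isolated_component noeth accM injp AssN prQ nemb sL) => x Lx Qx.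
exact: (NQ x).1 (LN x Lx Qx) i.
Qed.
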